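(* Let $G$ be a graph with maximum degree $\Delta\geq 400$. Then every strong clique of $G$ has size at most $1.74\,\Delta^2$; that is, $$\omega(L^2(G))\leq 1.74\,\Delta^2 .$$
   Context: All graphs are finite and simple. $L^2(G)$ denotes the square of the line graph $L(G)$ of $G$, i.e. the graph with vertex set $E(G)$ in which two distinct edges of $G$ are adjacent if and only if they share an endvertex or some edge of $G$ joins an endvertex of one to an endvertex of the other. A strong clique of $G$ is a set of edges of $G$ that forms a clique in $L^2(G)$, and $\omega$ denotes the clique number. *)

(* Defs.v *)
From mathcomp Require Import all_boot.

Set Implicit Arguments.
Unset Strict Implicit.
Unset Printing Implicit Defensive.

Record sgraph := SGraph {
  svertex :> finType;
  adj : rel svertex;
  adj_sym : symmetric adj;
  adj_irr : irreflexive adj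
}.

Definition degree (G : sgraph) (x : G) : nat := #|[set y : G | adj x y]|.

Definition max_degree (G : sgraph) : nat := \max_(x : G) degree x.

Definition edges (G : sgraph) : {set {set G}} :=
  [set A : {set G} | [exists x : G, exists y : G, adj x y && (A == [set x; y])]].

Definition clique (G : sgraph) (S : {set G}) : bool :=
  [forall x in S, forall y in S, (x != y) ==> adj x y].

Definition clique_number (G : sgraph) : nat :=
  \max_(S : {set G} | clique S) #|S|.

Definition square_adj (G : sgraph) : rel G :=
  [rel x y | (x != y) && (adj x y || [exists z : G, adj x z && adj z y])].

Lemma square_adj_sym (G : sgraph) : symmetric (@square_adj G).
Proof.
move=> x y; rewrite /square_adj /= eq_sym adj_sym; congr (_ && (_ || _)).
by apply: eq_existsb => z; rewrite andbC adj_sym (adj_sym x).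
Qed.

Lemma square_adj_irr (G : sgraph) : irreflexive (@square_adj G).
Proof. by move=> x; rewrite /square_adj /= eqxx. Qed.

Definition square (G : sgraph) : sgraph :=
  SGraph (@square_adj_sym G) (@square_adj_irr G).

Definition edge_type (G : sgraph) : finType := {A : {set G} | A \in edges G}.

Definition line_adj (G : sgraph) : rel (edge_type G) :=
  [rel A B | (A != B) && (val A :&: val B != set0)].

Lemma line_adj_sym (G : sgraph) : symmetric (@line_adj G).
Proof. by move=> A B; rewrite /line_adj /= eq_sym setIC. Qed.

Lemma line_adj_irr (G : sgraph) : irreflexive (@line_adj G).
Proof. by move=> A; rewrite /line_adj /= eqxx. Qed.

Definition line_graph (G : sgraph) : sgraph :=
  SGraph (@line_adj_sym G) (@line_adj_irr G).

Definition line_square (G : sgraph) : sgraph := square (line_graph G).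

Lemma line_square_adjE (G : sgraph) (A B : edge_type G) :
  adj (A : line_square G) (B : line_square G) =
  (A != B) && ((val A :&: val B != set0) ||
               [exists x in val A, exists y in val B, adj x y]).
Proof.
rewrite /= /square_adj /= /line_adj /=; case: eqVneq => //= nAB.
apply/orP/orP.
  case=> [h|]; first by left.
  case/existsP=> -[c cE] /=.
  case/and3P=> /andP[_ /set0Pn[x /setIP[xA xC]]] _ /set0Pn[y /setIP[yC yB]].
  have [exy|nxy] := eqVneq x y.
    by left; apply/set0Pn; exists x; rewrite inE xA exy yB.
  right; apply/existsP; exists x; rewrite xA; apply/existsP; exists y.
  rewrite yB /=.
  move: cE; rewrite inE => /existsP[u /existsP[v /andP[uv /eqP eC]]].
  move: xC yC nxy; rewrite eC !inE.
  by case/orP=> /eqP-> /orP[]/eqP->; rewrite ?eqxx // adj_sym.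
case=> [h|]; first by left.
case/existsP=> x /andP[xA /existsP[y /andP[yB xy]]].
have Ce : [set x; y] \in edges G.
  by rewrite inE; apply/existsP; exists x; apply/existsP; exists y; rewrite xy eqxx.
pose C : edge_type G := exist _ [set x; y] Ce.
have [eAC|nAC] := eqVneq A C.
  by left; apply/set0Pn; exists y; rewrite eAC !inE eqxx orbT yB.
have [eCB|nCB] := eqVneq C B.
  by left; apply/set0Pn; exists x; rewrite -eCB !inE eqxx xA.
right; apply/existsP; exists C; rewrite nAC nCB /=.
by apply/andP; split; apply/set0Pn; [exists x | exists y];
  rewrite !inE eqxx ?orbT ?xA ?yB.
Qed.

Definition strong_clique (G : sgraph) (S : {set edge_type G}) : bool :=
  @clique (line_square G) S.

(* Main.v *)
(** Let [F] be a strong clique, [D] the maximum degree of [G], [v] a vertex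
    lying on the largest number [k] of edges of [F], [U] the set of the [k]
    neighbours of [v] along [F] and [N] the neighbourhood of [v] in [G]. At most
    [(D - k) k] edges of [F] meet [N :\: U]. For a vertex [x] let [w x] be the
    number of neighbours of [x] in [U] and [p x] the number of those joined to
    [x] by an edge of [F]; the sum of all [w x] is at most [k D], and at most
    [sum_x p x] edges of [F] meet [U]. An edge [xy] of [F] avoiding [N] is close
    to [vu] for every [u] in [U], which forces [w x + w y >= k]. Letting each
    vertex pay 0, 1/2 or 1 for every such edge it lies on, according to whether
    [w x / k] is below 5/12, between 5/12 and 7/12 or above 7/12, all these edges
    are paid for, and [x] pays at most [1.74 w x - p x] since it lies on at most
    [k - p x] of them. Altogether [F] has at most
    [(D - k) k + 1.74 k D <= 1.74 D^2] edges. *)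
Require Import Defs.
From mathcomp Require Import all_boot all_order all_algebra.
From mathcomp Require Import zify.
Import Order.TTheory GRing.Theory Num.Theory.

(** Both sides bound the sum of [f x] over the incidences [x \in e], taken edge by edge and vertex
    by vertex. *)
Lemma weighted_double_count (T : finType) (A : {set {set T}})
    (c : nat) (f : T -> nat) :
  (forall e, e \in A -> c <= \sum_(x in e) f x) ->
  c * #|A| <= \sum_x f x * #|[set e in A | x \in e]|.
Proof.
move=> cA; rewrite mulnC -sum_nat_const.
apply: (@leq_trans (\sum_(e in A) \sum_(x in e) f x)); first exact: leq_sum.
rewrite (exchange_big_dep predT) //=; apply: leq_sum => x _.
by rewrite sum_nat_const mulnC cardsE leqnn.
Qed.

(** Double counting with [c = 1], the weight being the indicator of [B]. *)
Lemma leq_card_cover (T : finType) (A : {set {set T}}) (B : {set T}) :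
  (forall e, e \in A -> ~~ [disjoint e & B]) ->
  #|A| <= \sum_(x in B) #|[set e in A | x \in e]|.
Proof.
move=> AB; rewrite -[#|A|]mul1n [leqRHS]big_mkcond /=.
rewrite (eq_bigr (fun x => (x \in B) * #|[set e in A | x \in e]|)); last first.
  by move=> x _; case: (x \in B); rewrite ?mul1n.
apply: weighted_double_count => e /AB /pred0Pn[x /andP[/= xe xB]].
by rewrite (bigD1 x) //= xB.
Qed.

Lemma set2_inj (T : finType) (v : T) : injective (fun u => [set v; u]).
Proof.
move=> u u' /setP E; have := E u; have := E u'; rewrite !inE !eqxx !orbT.
by move=> /orP[/eqP->|/eqP->] //; rewrite orbb => /esym/eqP->.
Qed.

Section StrongClique.

Variables (G : sgraph) (F : {set {set G}}).
Hypothesis F_edges : F \subset edges G.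

Lemma F_adj (x y : G) : [set x; y] \in F -> adj x y.
Proof.
move=> /(subsetP F_edges); rewrite inE.
move=> /existsP[a /existsP[b /andP[ab /eqP E]]].
have nab : a != b by apply: contraTneq ab => ->; rewrite adj_irr.
have: #|[set x; y]| = 2 by rewrite E cards2 nab.
rewrite cards2; case: eqP => //= /eqP nxy _.
have: x \in [set a; b] by rewrite -E !inE eqxx.
have: y \in [set a; b] by rewrite -E !inE eqxx orbT.
rewrite !inE => /orP[]/eqP yE /orP[]/eqP xE; move: nxy; rewrite xE yE ?eqxx //.
by rewrite adj_sym.
Qed.

Lemma F_set2 (e : {set G}) (x : G) :
  e \in F -> x \in e -> exists y, e = [set x; y].
Proof.
move=> /(subsetP F_edges); rewrite inE.
move=> /existsP[a /existsP[b /andP[_ /eqP->]]].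
by rewrite !inE => /orP[]/eqP->; [exists b | exists a; rewrite setUC].
Qed.

Lemma imset_set2 (x : G) :
  [set [set x; u] | u in [set u | [set x; u] \in F]] = [set e in F | x \in e].
Proof.
apply/setP=> e; rewrite inE; apply/imsetP/andP => [[u]|[eF xe]].
  by rewrite inE => uF ->; rewrite uF !inE eqxx.
by have [y E] := F_set2 _ _ eF xe; exists y; rewrite // inE -E.
Qed.

Lemma card_F_nbrs (x : G) :
  #|[set u | [set x; u] \in F]| = #|[set e in F | x \in e]|.
Proof. by rewrite -imset_set2 (card_imset _ (@set2_inj _ x)). Qed.

Hypothesis F_strong : forall e f, e \in F -> f \in F -> [disjoint e & f] ->
  exists x y, [/\ x \in e, y \in f & adj x y].

Lemma card_strong_clique (v0 : G) :
  100 * #|F| <= 174 * max_degree G ^ 2.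
Proof.
set D := max_degree G; pose dF x := #|[set e in F | x \in e]|.
have [v dFv] : exists v, forall x, dF x <= dF v.
  by case: (@arg_maxnP _ v0 predT dF isT) => v _ vP; exists v => x; apply: vP.
pose k := dF v; pose N := [set u | adj v u].
pose U := [set u | [set v; u] \in F].
have cU : #|U| = k by exact: card_F_nbrs.
have UN : U \subset N by apply/subsetP => u; rewrite !inE; apply: F_adj.
have degD (x : G) : degree x <= D by exact: (leq_bigmax x).
have cN : #|N| <= D by exact: degD.
have kD : k <= D by rewrite -cU (leq_trans (subset_leq_card UN)).
pose w x := #|[set u in U | adj u x]|.
pose p x := #|[set u in U | [set u; x] \in F]|.
pose O := [set e in F | [disjoint e & N]].
pose d x := #|[set e in O | x \in e]|.
have pw x : p x <= w x.
  apply/subset_leq_card/subsetP => u; rewrite !inE => /andP[->] /=.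
  exact: F_adj.
have wk x : w x <= k.
  by rewrite -cU; apply/subset_leq_card/subsetP => u; rewrite inE => /andP[].
(* The edges counted by [p x] end in [U], hence meet [N], while those counted by [d x] avoid [N]: no
   edge of [F] at [x] is counted twice. *)
have pdk x : p x + d x <= k.
  apply: leq_trans (dFv x); rewrite /p -(card_imset _ (@set2_inj _ x)) -cardsUI.
  rewrite [X in _ + X](_ : _ = 0) ?addn0; last first.
    apply/eqP; rewrite cards_eq0; apply/eqP/setP => e; rewrite in_setI in_set0.
    apply/negP => /andP[/imsetP[u]].
    rewrite inE => /andP[uU _ ->]; rewrite !inE => /andP[/andP[_ dis] _].
    have := disjointFr dis (x := u); rewrite !inE eqxx orbT => /(_ isT).
    by have := subsetP UN u uU; rewrite inE => ->.
  apply/subset_leq_card/subsetP => e; rewrite in_setU.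
  case/orP => [/imsetP[u]|]; last by rewrite !inE => /andP[/andP[-> _] ->].
  by rewrite inE => /andP[_ uF] ->; rewrite !inE eqxx setUC uF.
have sum_w : \sum_x w x <= k * D.
  rewrite -cU -sum_nat_const; under eq_bigr => x _ do rewrite /w -sum1dep_card.
  rewrite (exchange_big_dep (mem U)) /=; last by move=> x u _ /andP[].
  apply: leq_sum => u uU; apply: leq_trans (degD u).
  rewrite sum1dep_card; apply/subset_leq_card/subsetP => x.
  by rewrite !inE => /andP[].
(* Both sides count the pairs [(u, x)] with [u] in [U] and [[set u; x]] in [F]. *)
have sum_p : \sum_x p x = \sum_(u in U) dF u.
  under eq_bigr => x _ do rewrite /p -sum1dep_card.
  rewrite (exchange_big_dep (mem U)) /=; last by move=> x u _ /andP[].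
  apply: eq_bigr => u uU; rewrite /dF -card_F_nbrs sum1dep_card.
  by apply: eq_card => x; rewrite !inE; move: uU; rewrite inE => ->.
(* Twice the payment, to stay in [nat]. Since 5/12 + 7/12 = 1, if one end of an edge has [w] below
   5k/12, then [wxy] puts the other strictly above 7k/12. *)
pose psi x :=
  if 12 * w x < 5 * k then 0 else if 12 * w x <= 7 * k then 1 else 2.
have psi_edge e : e \in O -> 2 <= \sum_(x in e) psi x.
  rewrite inE => /andP[eF eN].
  have [x xe] : exists x, x \in e.
    move: (subsetP F_edges _ eF); rewrite inE.
    move=> /existsP[x /existsP[y /andP[_ /eqP->]]].
    by exists x; rewrite !inE eqxx.
  have [y E] := F_set2 _ _ eF xe.
  have xy : x != y.
    have: adj x y by [apply: F_adj; rewrite -E].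
    by apply: contraTneq => ->; rewrite adj_irr.
  have NxP z : z \in e -> ~~ adj v z.
    by move=> ze; have := disjointFr eN ze; rewrite inE => ->.
  have ve : v \notin e.
    apply/negP => ve; have [z Ez] := F_set2 _ _ eF ve.
    have ze : z \in e by rewrite Ez !inE eqxx orbT.
    by have := NxP z ze; rewrite F_adj // -Ez.
  (* The ends of [e] are not adjacent to [v], so the edge linking [[set v; u]] to [e] must start at
     [u]: the neighbourhoods of [x] and [y] cover [U]. *)
  have wxy : k <= w x + w y.
    rewrite -cU /w -cardsUI; apply: leq_trans (leq_addr _ _).
    apply/subset_leq_card/subsetP => u uU; rewrite !inE.
    move: (uU); rewrite inE => vuF; rewrite vuF /=.
    have vu := F_adj _ _ vuF.
    have ue : u \notin e by apply: contraL vu; apply: NxP.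
    have [|a [b [ae be ab]]] := F_strong _ _ vuF eF.
      rewrite disjoint_subset; apply/subsetP => z.
      by rewrite !inE => /orP[]/eqP->.
    move: ae; rewrite !inE => /orP[/eqP av|/eqP au].
      by move: ab; rewrite av (negbTE (NxP b be)).
    by move: be ab; rewrite E au !inE => /orP[]/eqP-> ->; rewrite ?orbT.
  rewrite E big_setU1 ?inE //= big_set1 /psi; clear - wxy.
  by do 2 case: ifP => ?; do 2 try case: ifP => ?; lia.
have cO := weighted_double_count _ _ _ _ psi_edge.
(* With [d x <= k - p x] and [p x <= w x], the middle case needs 50k <= 124 [w x], and 124 * 5/12 >
   51; the top case needs 100k <= 174 [w x], and 174 * 7/12 > 101. *)
have pay x : 100 * p x + 50 * (psi x * d x) <= 174 * w x.
  have := pw x; have := wk x; have := pdk x; rewrite /psi.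
  by case: ifP => ?; try case: ifP => ?; lia.
(* Each vertex of [N :\: U] lies on at most [k] edges of [F]; those of [U] are accounted for by
   [sum_p]. *)
have cI : #|F :\: O| <= (D - k) * k + \sum_x p x.
  apply: (@leq_trans (\sum_(u in N) dF u)).
    apply: (@leq_trans (\sum_(u in N) #|[set e in F :\: O | u \in e]|)).
      apply: leq_card_cover => e; rewrite !inE negb_and.
      by case/andP => /orP[/negP//|].
    apply: leq_sum => u _; apply/subset_leq_card/subsetP => e.
    by rewrite !inE => /andP[/andP[_ ->] ->].
  rewrite (big_setID U) /= (setIidPr UN) -sum_p addnC leq_add2r.
  apply: (@leq_trans (\sum_(u in N :\: U) k)); first by apply: leq_sum.
  by rewrite sum_nat_const cardsD (setIidPr UN) cU leq_mul2r leq_sub2r ?orbT.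
have total : \sum_x (100 * p x + 50 * (psi x * d x)) <= 174 * (k * D).
  apply: leq_trans (leq_mul (leqnn 174) sum_w).
  by rewrite big_distrr; apply: leq_sum.
move: total; rewrite big_split -!big_distrr /=.
have OF : O \subset F by apply/subsetP => e; rewrite inE => /andP[].
have cF : #|F| = #|O| + #|F :\: O| by rewrite -(cardsID O F) (setIidPr OF).
move: cO cI; rewrite -/d cF; move: (\sum_x p x) (\sum_x _) => P Q.
suff: 100 * ((D - k) * k) + 174 * (k * D) <= 174 * D ^ 2 by lia.
(* Writing [D] as [m + n] with [m = D - k] removes the truncated subtraction; what remains is 100mn
   <= 174m(m + n). *)
have aux m n : 100 * (m * n) + 174 * (n * (m + n)) <= 174 * (m + n) ^ 2.
  by rewrite -mulnn; nia.
by have := aux (D - k) k; rewrite subnK.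
Qed.

End StrongClique.

(** For disjoint edges, [line_square_adjE] leaves only the joining edge that [F_strong] asks for. *)
Lemma card_strong_clique_edges (G : sgraph) (S : {set edge_type G}) (v0 : G) :
  strong_clique S -> 100 * #|S| <= 174 * max_degree G ^ 2.
Proof.
move=> Scl; rewrite -(card_imset _ val_inj).
apply: card_strong_clique => // [|_ _ /imsetP[A AS ->] /imsetP[B BS ->] dAB].
  by apply/subsetP => _ /imsetP[A _ ->]; apply: valP.
have nAB : A != B.
  apply: contraTneq dAB => <-; move: (valP A); rewrite inE.
  move=> /existsP[x /existsP[y /andP[_ /eqP->]]].
  by apply/pred0Pn; exists x; rewrite /= !inE eqxx.
move/forall_inP: Scl => /(_ A AS)/forall_inP/(_ B BS)/implyP/(_ nAB).
rewrite line_square_adjE nAB /= setI_eq0 dAB /=.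
by case/exists_inP => x xA /exists_inP[y yB xy]; exists x, y.
Qed.

Local Open Scope ring_scope.

(* Over an abstract field, because rewriting with numerals of [rat] diverges. *)
Lemma ler_nat_frac (R : numFieldType) (a b c n m : nat) :
  (b.+1 * n <= a * m ^ c)%N -> n%:R <= a%:R / b.+1%:R * m%:R ^+ c :> R.
Proof.
by move=> h; rewrite mulrAC ler_pdivlMr ?ltr0Sn // -natrX -!natrM ler_nat mulnC.
Qed.

Theorem theorem3 (G : sgraph) (hDelta : (400 <= max_degree G)%N) :
  (forall S : {set edge_type G}, strong_clique S ->
     #|S|%:R <= 174%:R / 100%:R * (max_degree G)%:R ^+ 2 :> rat)
  /\ (clique_number (line_square G))%:R
       <= 174%:R / 100%:R * (max_degree G)%:R ^+ 2 :> rat.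
Proof.
(* Without vertices the maximum degree would be 0. *)
have [v0 _] : exists v0 : G, true.
  case: (pickP (fun _ : G => true)) => [v0 _|G0]; first by exists v0.
  by move: hDelta; rewrite /max_degree big_pred0.
split=> [S Scl|]; first by apply/ler_nat_frac/card_strong_clique_edges.
apply: ler_nat_frac; rewrite /clique_number.
elim/big_ind: _ => [|m n hm hn|S Scl].
- by rewrite muln0.
- by rewrite /maxn; case: ifP.
- exact: card_strong_clique_edges.
Qed.
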